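(* Let $(G_k)$ be a sequence of connected graphs, $G_k$ of order $n_k$, with $\mu(G_k)=o(1/n_k)$. For each $k$ let $H_k$ be a graph and $S_k\subseteq V(G_k)$, and let $G'_k$ be a connected graph obtained from the disjoint union $G_k\cup H_k$ by adding some edges between vertices of $H_k$ and vertices of $S_k$. Suppose there is a constant $K$ such that $|S_k|\le K$, $|V(H_k)|\le K$, and any two vertices of $S_k$ are at distance at most $K$ in $G_k$. Then $\mu(G'_k)=(1+o(1))\mu(G_k)$.
   Context: Graphs are simple. $\mu(G)$ is the second smallest eigenvalue of the Laplacian $L(G)$ (degree matrix minus adjacency matrix). *)

(* Defs.v *)
From mathcomp Require Import all_boot all_order all_algebra.
From mathcomp Require Import all_classical all_reals all_analysis.
From mathcomp Require Import polyrcf.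
Set Implicit Arguments. Unset Strict Implicit. Unset Printing Implicit Defensive.
Import Order.TTheory GRing.Theory Num.Theory numFieldNormedType.Exports.
Local Open Scope ring_scope.

Record sgraph := SGraph {
  vertex :> finType;
  adj : rel vertex;
  adj_sym : symmetric adj;
  adj_irrefl : irreflexive adj }.

Definition gconnected (G : sgraph) : Prop :=
  (0 < #|G|)%N /\ forall x y : G, connect (@adj G) x y.

(* Length of a shortest walk from x to y. The search range is exhaustive, since
   a shortest walk has fewer than #|G| edges; the value is #|G| when y cannot
   be reached from x. *)
Definition gdist (G : sgraph) (x y : G) : nat :=
  find (fun d => [exists p : d.-tuple G, path (@adj G) x p && (last x p == y)])
       (iota 0 #|G|).

Definition degree (G : sgraph) (x : G) : nat := #|[set y | adj x y]|.

Definition degree_mx (R : realType) (G : sgraph) : 'M[R]_#|G| :=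
  diag_mx (\row_i (degree (enum_val i))%:R).

Definition adjacency_mx (R : realType) (G : sgraph) : 'M[R]_#|G| :=
  \matrix_(i, j) (adj (enum_val i) (enum_val j))%:R.

Definition laplacian (R : realType) (G : sgraph) : 'M[R]_#|G| :=
  degree_mx R G - adjacency_mx R G.

(* Real eigenvalues in nondecreasing order, repeated according to their
   multiplicity in the characteristic polynomial; rootsR lists the distinct
   real roots. *)
Definition eigenvalues (R : realType) (n : nat) (A : 'M[R]_n) : seq R :=
  let p := char_poly A in
  sort <=%R (flatten [seq nseq (mup x p) x | x <- rootsR p]).

(* The second smallest Laplacian eigenvalue, when G has at least two vertices;
   otherwise the junk value 0. *)
Definition algebraic_connectivity (R : realType) (G : sgraph) : R :=
  nth 0 (eigenvalues (laplacian R G)) 1.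

Section Attach.
Variables (G H : sgraph) (E : {set H * G}).

Definition attach_adj (u v : G + H) : bool :=
  match u, v with
  | inl x, inl y => adj x y
  | inr x, inr y => adj x y
  | inl x, inr h | inr h, inl x => (h, x) \in E
  end.

Lemma attach_sym : symmetric attach_adj.
Proof. by move=> [x|x] [y|y] //=; exact: adj_sym. Qed.

Lemma attach_irrefl : irreflexive attach_adj.
Proof. by move=> [x|x] /=; exact: adj_irrefl. Qed.

(* The disjoint union of G and H together with the edges hx for (h, x) in E. *)
Definition attach : sgraph := SGraph attach_sym attach_irrefl.

End Attach.

(* Main.v *)
(** A Laplacian eigenvector [f] for [k] satisfies [|f u - f v| <= k * sum |f|]
    along every edge, because the flow out of a superlevel set of [f] is [k]
    times the sum of [f] over it. Hence, with [n] the order of [G], an edge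
    contributes at most [mu^2 n = o(mu)] to the energy of a unit eigenvector of
    [G], so extending that eigenvector by a constant, its value at some vertex
    of [S], on [H] gives a test function for [G'], whence
    [mu' <= mu (1 + O(mu n))]. Conversely, walking from a vertex to one where
    the eigenvector has the opposite sign shows that a unit eigenvector of [G']
    is [o(1)] everywhere; it therefore keeps almost all of its variance when
    restricted to [G], whence [mu (1 - O(mu' n)) <= mu']. *)
Require Import Defs.
From mathcomp Require Import all_boot all_order all_algebra.
From mathcomp Require Import all_classical all_reals all_analysis.
From mathcomp Require Import polyrcf.
From mathcomp Require complex.
From mathcomp Require Import ring lra.
Set Implicit Arguments.
Unset Strict Implicit.
Unset Printing Implicit Defensive.
Import Order.TTheory GRing.Theory Num.Theory numFieldNormedType.Exports.
Local Open Scope classical_set_scope.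
Local Open Scope ring_scope.

(** * Eigenvalue lists and split characteristic polynomials *)

Lemma mup_prod_XsubC (F : fieldType) (I : Type) (s : seq I) (r : I -> F) (x : F) :
  mup x (\prod_(i <- s) ('X - (r i)%:P)) = count_mem x [seq r i | i <- s].
Proof.
elim: s => [|i s IHs] /=; first by rewrite big_nil mupNroot // root1.
rewrite big_cons mupM ?polyXsubC_eq0 ?IHs //; last first.
  by apply/monic_neq0/monic_prod => j _; exact: monicXsubC.
by rewrite -['X - _]expr1 mup_XsubCX; case: eqP.
Qed.

(** Both lists are sorted, so it suffices to compare multiplicities; for a split polynomial, the
    multiplicity of a root is the number of indices that carry it. *)
Lemma eigenvalues_prod_XsubC (R : realType) (n : nat) (A : 'M[R]_n) (r : 'I_n -> R) :
  char_poly A = \prod_i ('X - (r i)%:P) ->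
  eigenvalues A = sort <=%R [seq r i | i <- enum 'I_n].
Proof.
move=> chA; apply/perm_sortP; [exact: le_total|exact: le_trans|exact: le_anti|].
have p_neq0 : char_poly A != 0 by rewrite monic_neq0 // char_poly_monic.
apply/allP => x _ /=; rewrite count_flatten -map_comp.
have -> : count_mem x [seq r i | i <- enum 'I_n] = mup x (char_poly A).
  by rewrite chA -mup_prod_XsubC big_enum.
have -> : [seq (count_mem x \o fun y => nseq (mup y (char_poly A)) y) y | y <- rootsR (char_poly A)]
    = [seq ((y == x) * mup x (char_poly A))%N | y <- rootsR (char_poly A)].
  by apply: eq_map => y /=; rewrite count_nseq /=; case: eqP => [->|].
rewrite sumnE big_map -big_distrl /=.
rewrite -big_mkcond /= sum1_count count_uniq_mem; last first.
  by apply: (sorted_uniq lt_trans ltxx); exact: sorted_roots.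
case: (boolP (x \in rootsR _)) => [_|xNr]; rewrite ?mul1n //.
rewrite mul0n eq_sym mupNroot //; apply: contra xNr.
by rewrite (roots_onP (roots_on_rootsR p_neq0)).
Qed.

Lemma char_poly_similar (F : fieldType) (n : nat) (P A D : 'M[F]_n) :
  P \in unitmx -> P *m A = D *m P -> char_poly A = char_poly D.
Proof.
move=> Pu PA; pose P' := map_mx (@polyC F) P.
have detP : \det P' != 0.
  by rewrite det_map_mx polyC_eq0 -unitfE -unitmxE.
apply: (mulfI detP); rewrite /char_poly -det_mulmx [RHS]mulrC -det_mulmx.
congr (\det _); rewrite /char_poly_mx mulmxBr mulmxBl.
by rewrite -!map_mxM PA scalar_mxC.
Qed.

(** * Spectral theorem for real symmetric matrices, deduced from the complex one *)

Section RealSpectral.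
Import complex.
Local Open Scope complex_scope.
Variable R : realType.
Local Notation C := R[i].
Local Notation toC := (real_complex R).

Lemma Re_sum (I : Type) (s : seq I) (F : I -> C) :
  Re (\sum_(i <- s) F i) = \sum_(i <- s) Re (F i).
Proof. by apply: (big_morph (@Re R)) => // -[? ?] [? ?]. Qed.

Lemma Im_sum (I : Type) (s : seq I) (F : I -> C) :
  Im (\sum_(i <- s) F i) = \sum_(i <- s) Im (F i).
Proof. by apply: (big_morph (@Im R)) => // -[? ?] [? ?]. Qed.

Lemma ReMr (z : C) (x : R) : Re (z * x%:C) = Re z * x.
Proof. by case: z => u v /=; rewrite mulr0 subr0. Qed.

Lemma ReMl (z : C) (x : R) : Re (x%:C * z) = x * Re z.
Proof. by case: z => u v /=; rewrite mul0r subr0. Qed.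

Lemma ImMr (z : C) (x : R) : Im (z * x%:C) = Im z * x.
Proof. by case: z => u v /=; rewrite mulr0 add0r. Qed.

Lemma ImMl (z : C) (x : R) : Im (x%:C * z) = x * Im z.
Proof. by case: z => u v /=; rewrite mul0r addr0. Qed.

(* The rows of [a] and [b] are the real and imaginary parts of a unitary
   eigenbasis. *)
Lemma symmetric_spectral (n : nat) (A : 'M[R]_n) : A^T = A ->
  exists (r : 'I_n -> R) (a b : 'M[R]_n),
  let D := diag_mx (\row_i r i) in
  [/\ char_poly A = \prod_i ('X - (r i)%:P),
      a *m A = D *m a /\ b *m A = D *m b,
      a^T *m a + b^T *m b = 1%:M,
      a *m a^T + b *m b^T = 1%:M &
      b *m a^T = a *m b^T].
Proof.
move=> symA; pose AC := map_mx toC A; pose P := spectralmx AC.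
have AH : AC \is hermsymmx.
  apply: realsym_hermsym.
    by apply/is_hermitianmxP; rewrite expr0 scale1r /= map_mx_id // /AC map_trmx symA.
  by apply/mxOverP => i j; rewrite mxE complex_real.
have Pu : P \in unitmx by exact: spectral_unit.
have /orthomx_spectralP eqA := hermitian_normalmx AH.
pose r i := Re (spectral_diag AC 0 i).
have dE : spectral_diag AC = map_mx toC (\row_i r i).
  apply/rowP => i; rewrite !mxE; apply/esym/RRe_real.
  by have /mxOverP -> := hermitian_spectral_diag_real AH.
have PA : P *m AC = map_mx toC (diag_mx (\row_i r i)) *m P.
  by rewrite [in LHS]eqA -/P dE map_diag_mx !mulmxA mulmxV // mul1mx.
(* The real parts of the two unitarity relations give the identities with [1%:M]; the imaginary part
   of [PPh] gives [b *m a^T = a *m b^T]. *)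
have PPh := unitarymxP (spectral_unitarymx AC).
have PhP := mulmx1C PPh.
rewrite -/P in PPh PhP.
exists r, (map_mx (@Re R) P), (map_mx (@Im R) P); split.
- apply: (map_poly_inj toC); rewrite map_char_poly.
  rewrite (char_poly_similar Pu PA) -map_char_poly char_poly_trig ?diag_mx_is_trig //.
  by congr (map_poly _ _); apply: eq_bigr => i _; rewrite !mxE eqxx.
- split; apply/matrixP => i j.
    transitivity (Re ((P *m AC) i j)); last rewrite PA; rewrite !mxE Re_sum.
      by apply: eq_bigr => k _; rewrite !mxE ReMr.
    by apply: eq_bigr => k _; rewrite !mxE ReMl.
  transitivity (Im ((P *m AC) i j)); last rewrite PA; rewrite !mxE Im_sum.
    by apply: eq_bigr => k _; rewrite !mxE ImMr.
  by apply: eq_bigr => k _; rewrite !mxE ImMl.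
- apply/matrixP => i j.
  transitivity (Re (((P ^t* )%sesqui *m P) i j)); last first.
    by rewrite PhP !mxE; case: (i == j).
  rewrite !mxE Re_sum -big_split /=; apply: eq_bigr => k _; rewrite !mxE.
  by case: (P k i) => x y; case: (P k j) => z t /=; rewrite mulNr opprK.
- apply/matrixP => i j.
  transitivity (Re ((P *m (P ^t* )%sesqui) i j)); last first.
    by rewrite PPh !mxE; case: (i == j).
  rewrite !mxE Re_sum -big_split /=; apply: eq_bigr => k _; rewrite !mxE.
  by case: (P i k) => x y; case: (P j k) => z t /=; rewrite mulrN opprK.
- apply/matrixP => i j; apply/eqP; rewrite -subr_eq0; apply/eqP.
  transitivity (Im ((P *m (P ^t* )%sesqui) i j)); last first.
    by rewrite PPh !mxE; case: (i == j).
  rewrite !mxE Im_sum -sumrB; apply: eq_bigr => k _; rewrite !mxE.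
  by case: (P i k) => x y; case: (P j k) => z t /=; rewrite mulrN addrC.
Qed.

End RealSpectral.

(** Up to sign, [v *m a^T] and [v *m b^T] are the real and imaginary parts of the coordinates of [v]
    in the unitary eigenbasis, so each bracket is a squared modulus. *)
Lemma spectral_form (R : realType) (n : nat) (A a b : 'M[R]_n) (r : 'I_n -> R)
    (v : 'rV[R]_n) :
  A^T = A -> a *m A = diag_mx (\row_i r i) *m a ->
  b *m A = diag_mx (\row_i r i) *m b -> a^T *m a + b^T *m b = 1%:M ->
  (v *m A *m v^T) 0 0 =
  \sum_i r i * ((v *m a^T) 0 i ^+ 2 + (v *m b^T) 0 i ^+ 2).
Proof.
move=> symA aA bA ab1; set D := diag_mx _ in aA bA.
have form c : c *m A = D *m c -> v *m A *m c^T *m c *m v^T =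
    v *m c^T *m D *m (v *m c^T)^T.
  move=> cA; rewrite -(mulmxA v A) -[A *m c^T]trmxK trmx_mul symA trmxK cA.
  by rewrite trmx_mul tr_diag_mx trmx_mul trmxK !mulmxA.
have -> : v *m A *m v^T = v *m A *m a^T *m a *m v^T + v *m A *m b^T *m b *m v^T.
  by rewrite -mulmxDl -!(mulmxA (v *m A)) -mulmxDr ab1 mulmx1.
rewrite (form a aA) (form b bA) mxE; under eq_bigr do rewrite mulrDr.
rewrite big_split /=.
by congr (_ + _); rewrite mxE; apply: eq_bigr => i _;
   rewrite mul_mx_diag !mxE; ring.
Qed.

(** * The Laplacian as an operator on vertex functions, and its energy *)

Section Graph.
Variables (R : realType) (G : sgraph).
Implicit Types f g : G -> R.

Definition lap f x : R := \sum_(y | adj x y) (f x - f y).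

(** Each edge is counted in both orientations, so this is twice the Laplacian quadratic form; hence
    the factors 2 in later bounds. *)
Definition energy f : R := \sum_x \sum_(y | adj x y) (f x - f y) ^+ 2.

Lemma energy_ge0 f : 0 <= energy f.
Proof. by apply: sumr_ge0 => x _; apply: sumr_ge0 => y _; exact: sqr_ge0. Qed.

(** Summation by parts: exchanging the endpoints of each edge gives a second expression for the
    right-hand sum, and the two add up to the squares. *)
Lemma energy_lap f : energy f = 2 * \sum_x f x * lap f x.
Proof.
have swap : \sum_x \sum_(y | adj x y) f x * (f x - f y) =
    \sum_x \sum_(y | adj x y) f y * (f y - f x).
  rewrite (exchange_big_dep predT) //=; apply: eq_bigr => x _.
  by apply: eq_bigl => y; rewrite adj_sym.
under [in RHS]eq_bigr do rewrite /lap mulr_sumr.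
rewrite mulr_natl mulr2n {2}swap -big_split /=; apply: eq_bigr => x _.
by rewrite -big_split; apply: eq_bigr => y _ /=; ring.
Qed.

Lemma sum_lap f : \sum_x lap f x = 0.
Proof.
have swap : \sum_x lap f x = - \sum_x lap f x.
  rewrite [LHS](exchange_big_dep predT) //= -sumrN; apply: eq_bigr => x _.
  rewrite -sumrN; apply: eq_big => y; first by rewrite adj_sym.
  by rewrite opprB.
by apply/eqP; rewrite -[_ == 0](mulrn_eq0 _ 2) mulr2n {1}swap addNr.
Qed.

Lemma edge_le_energy f x y : adj x y -> (f x - f y) ^+ 2 <= energy f.
Proof.
move=> xy; rewrite /energy (bigD1 x) //= (bigD1 y) //= -addrA lerDl addr_ge0 //.
  by apply: sumr_ge0 => z _; exact: sqr_ge0.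
by apply: sumr_ge0 => z _; apply: sumr_ge0 => t _; exact: sqr_ge0.
Qed.

Lemma energy0_const f : gconnected G -> energy f = 0 -> forall x y, f x = f y.
Proof.
move=> [_ Gc] f0 x y; have /connectP [p xp ->] := Gc x y.
elim: p x xp => [|z p IHp] x //= /andP [xz /IHp <-].
apply/eqP; rewrite -subr_eq0 -sqrf_eq0 eq_le sqr_ge0 andbT -f0.
exact: edge_le_energy.
Qed.

Definition vec f : 'rV[R]_#|G| := \row_i f (enum_val i).

Lemma sum_enum_val f : \sum_x f x = \sum_(i < #|G|) f (enum_val i).
Proof. by rewrite (reindex _ (onW_bij _ (enum_val_bij _))). Qed.

Lemma vec_mul f (c : 'cV[R]_#|G|) :
  (vec f *m c) 0 0 = \sum_x f x * c (enum_rank x) 0.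
Proof.
rewrite mxE sum_enum_val; apply: eq_bigr => i _.
by rewrite mxE enum_valK.
Qed.

Lemma laplacian_sym : (laplacian R G)^T = laplacian R G.
Proof.
apply/matrixP => i j; rewrite !mxE adj_sym; congr (_ - _).
by case: (eqVneq i j) => [->|_]; rewrite ?mulr0n.
Qed.

Lemma vec_laplacian f : vec f *m laplacian R G = vec (lap f).
Proof.
apply/rowP => j; rewrite mulmxBr !mxE.
under [X in _ - X]eq_bigr do rewrite !mxE.
have -> : \sum_i vec f 0 i * degree_mx R G i j =
    (degree (enum_val j))%:R * f (enum_val j).
  rewrite (bigD1 j) //= !mxE eqxx mulr1n mulrC big1 ?addr0 // => i /negPf ij.
  by rewrite !mxE ij mulr0n mulr0.
rewrite /lap sumrB sumr_const; congr (_ - _).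
  by rewrite mulr_natl; congr (_ *+ _); rewrite /degree cardsE.
rewrite -(sum_enum_val (fun x => f x * (adj x (enum_val j))%:R)) [RHS]big_mkcond.
by apply: eq_bigr => x _; rewrite adj_sym; case: adj; rewrite ?mulr1 ?mulr0.
Qed.

End Graph.

(** * Positivity, eigenvectors and the Poincaré inequality for [mu] *)

Section Connectivity.
Variables (R : realType) (G : sgraph).
Hypothesis Gconn : gconnected G.
Hypothesis G_gt1 : (1 < #|G|)%N.
Local Notation mu := (algebraic_connectivity R G).

Definition unvec (c : 'rV[R]_#|G|) (x : G) : R := c 0 (enum_rank x).

Lemma vec_unvec c : vec (unvec c) = c.
Proof. by apply/rowP => i; rewrite mxE /unvec enum_valK. Qed.

Lemma lap_unvec (c : 'rV[R]_#|G|) k x : c *m laplacian R G = k *: c ->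
  lap (unvec c) x = k * unvec c x.
Proof.
rewrite -{1}(vec_unvec c) vec_laplacian => /rowP /(_ (enum_rank x)).
by rewrite !mxE enum_rankK.
Qed.

Lemma row_eigen (m : 'M[R]_#|G|) r i x :
  m *m laplacian R G = diag_mx (\row_i r i) *m m ->
  lap (unvec (row i m)) x = r i * unvec (row i m) x.
Proof.
move=> mL; apply: lap_unvec; rewrite -row_mul mL.
by apply/rowP => j; rewrite mul_diag_mx !mxE.
Qed.

Lemma energy_eigen (f : G -> R) k : (forall x, lap f x = k * f x) ->
  energy f = 2 * k * \sum_x f x ^+ 2.
Proof.
move=> fk; rewrite energy_lap -mulrA; congr (_ * _); rewrite mulr_sumr.
by apply: eq_bigr => x _; rewrite fk; ring.
Qed.

Lemma eigen_const (f : G -> R) : (forall x, lap f x = 0) -> forall x y, f x = f y.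
Proof.
move=> f0; apply: energy0_const => //; rewrite (@energy_eigen f 0) ?mulr0 ?mul0r //.
by move=> x; rewrite mul0r.
Qed.

(* Connectedness makes 0 a simple eigenvalue whose complex eigenvectors are
   constant, so a function of zero sum has no component along the bottom
   eigenvector and no min-max argument is needed. *)
Lemma connectivity_spectrum :
  [/\ 0 < mu,
      exists f : G -> R, (exists x, f x != 0) /\ (forall x, lap f x = mu * f x) &
      forall g : G -> R, \sum_x g x = 0 ->
        mu * \sum_x g x ^+ 2 <= \sum_x g x * lap g x].
Proof.
have [r [a [b [chL [aL bL] ab1 ba1 abC]]]] := symmetric_spectral (laplacian_sym R G).
have mulrow (m1 m2 : 'M[R]_#|G|) i j : (m1 *m m2^T) i j =
    \sum_x unvec (row i m1) x * unvec (row j m2) x.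
  rewrite mxE (sum_enum_val (fun x => unvec (row i m1) x * unvec (row j m2) x)).
  by apply: eq_bigr => k _; rewrite /unvec enum_valK !mxE.
pose fa i := unvec (row i a); pose fb i := unvec (row i b).
have faE i x : lap (fa i) x = r i * fa i x by exact: row_eigen.
have fbE i x : lap (fb i) x = r i * fb i x by exact: row_eigen.
have nrm i j : \sum_x fa i x * fa j x + \sum_x fb i x * fb j x = (i == j)%:R.
  by rewrite -!mulrow; have /matrixP /(_ i j) := ba1; rewrite !mxE.
have skew i j : \sum_x fb i x * fa j x = \sum_x fa i x * fb j x.
  by rewrite -!mulrow abC.
(* The energies of the real and imaginary parts of a unit eigenvector add up to [2 * r i]. *)
have r_ge0 i : 0 <= r i.
  have := addr_ge0 (energy_ge0 (fa i)) (energy_ge0 (fb i)).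
  rewrite (energy_eigen (faE i)) (energy_eigen (fbE i)) -mulrDr.
  have -> : \sum_x fa i x ^+ 2 + \sum_x fb i x ^+ 2 = 1.
    transitivity ((i == i)%:R : R); last by rewrite eqxx.
    by rewrite -nrm; congr (_ + _); apply: eq_bigr => x _; rewrite expr2.
  by lra.
have const i : r i = 0 -> exists s t : R, (forall x, fa i x = s) /\ (forall x, fb i x = t).
  move=> ri0; have [x0 _] : exists x0 : G, x0 \in G by apply/card_gt0P; case: Gconn.
  exists (fa i x0), (fb i x0); split => x; apply: eigen_const => y.
    by rewrite faE ri0 mul0r.
  by rewrite fbE ri0 mul0r.
have n_gt0 : 0 < (#|G|)%:R :> R by rewrite ltr0n ltnW.
have dotc (f g : G -> R) p q : (forall x, f x = p) -> (forall x, g x = q) ->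
    \sum_x f x * g x = p * q * #|G|%:R.
  move=> fp gq; rewrite mulr_natr -sumr_const; apply: eq_bigr => x _.
  by rewrite fp gq.
have zero_uniq i j : r i = 0 -> r j = 0 -> i = j.
  move=> /const [s [t [fas fbt]]] /const [s' [t' [fas' fbt']]].
  apply/eqP; case: (eqVneq i j) => // /negPf ij.
  have := nrm i j; have := nrm i i; have := nrm j j; have := skew i j.
  rewrite ij !eqxx (dotc _ _ _ _ fas fas) (dotc _ _ _ _ fbt fbt).
  rewrite (dotc _ _ _ _ fas' fas') (dotc _ _ _ _ fbt' fbt').
  rewrite (dotc _ _ _ _ fas fas') (dotc _ _ _ _ fbt fbt').
  rewrite (dotc _ _ _ _ fbt fas') (dotc _ _ _ _ fas fbt') -!mulrDl.
  move=> /(mulIf (lt0r_neq0 n_gt0)) e1 e2 e3 /eqP.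
  rewrite mulf_eq0 (gt_eqF n_gt0) orbF => /eqP e4.
  (* The identity |z|^2 |z'|^2 = |z conj(z')|^2 for z = s + it and z' = s' + it': two constant unit
     vectors cannot be orthogonal. *)
  have : ((s * s + t * t) * #|G|%:R) * ((s' * s' + t' * t') * #|G|%:R) =
      ((s * s' + t * t') ^+ 2 + (t * s' - s * t') ^+ 2) * #|G|%:R ^+ 2 by ring.
  by rewrite e2 e3 e4 e1 subrr expr0n /= add0r mul0r mulr1 => /eqP; rewrite oner_eq0.
(* The constant function 1 is in the kernel of the Laplacian. *)
have [i2 ri2] : exists i, r i = 0.
  have : root (char_poly (laplacian R G)) 0.
    rewrite -eigenvalue_root_char; apply/eigenvalueP; exists (vec (fun=> 1)).
      apply/rowP => i; rewrite vec_laplacian scale0r !mxE /lap big1 // => y _.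
      exact: subrr.
    have [x0 _] : exists x0 : G, x0 \in G by apply/card_gt0P; case: Gconn.
    apply/eqP => /rowP /(_ (enum_rank x0)); rewrite !mxE => /eqP.
    by rewrite oner_eq0.
  rewrite chL => /rootP; rewrite horner_prod => /eqP /prodf_eq0 [i _].
  by rewrite hornerXsubC sub0r oppr_eq0 => /eqP ri; exists i.
have eigE : mu = (sort <=%R [seq r i | i <- enum 'I_#|G|])`_1.
  by rewrite /algebraic_connectivity (eigenvalues_prod_XsubC chL).
(* Sorting indices rather than values makes [mu] equal to [r i1] for a definite [i1], which comes
   with its eigenvector. *)
rewrite sort_map in eigE; set t := sort _ _ in eigE.
have tperm : perm_eq t (enum 'I_#|G|) by rewrite perm_sort.
have tsort : sorted (relpre r <=%R) t by apply: sort_sorted => i j; exact: le_total.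
have tuniq : uniq t by rewrite (perm_uniq tperm) enum_uniq.
have tmem i : i \in t by rewrite (perm_mem tperm) mem_enum.
have tsize : size t = #|G| by rewrite (perm_size tperm) size_enum_ord.
case: t eigE tsort tuniq tmem tsize {tperm} => [|i0 [|i1 t]] /=; try by move=> _ _ _ _ tsz; move: G_gt1; rewrite -tsz.
move=> mu_r /andP [r01 tpath] /and3P [i0t i1t _] tmem _.
have r1le i : i != i0 -> mu <= r i.
  move=> ii0; have := tmem i; rewrite !inE (negPf ii0) /= mu_r => /predU1P [->//|it].
  have r_trans : transitive (relpre r <=%R) by move=> y x z /=; exact: le_trans.
  by have /allP := order_path_min r_trans tpath; apply.
have ri0 : r i0 = 0.
  case: (eqVneq i2 i0) => [<- //|i20]; apply: le_anti; rewrite r_ge0 andbT.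
  by rewrite -ri2 (le_trans r01) // -mu_r r1le.
have mu_gt0 : 0 < mu.
  rewrite lt_neqAle {2}mu_r r_ge0 andbT eq_sym; apply/eqP; rewrite mu_r => ri1.
  by move: i0t; rewrite (zero_uniq _ _ ri0 ri1) mem_head.
split=> //.
  (* The complex eigenvector at [i1] has norm 1, so its real or its imaginary part is nonzero, and
     either one is a real eigenvector. *)
  case: (pselect (exists x, fa i1 x != 0)) => [fa_neq0|fa0].
    by exists (fa i1); split => // x; rewrite mu_r.
  case: (pselect (exists x, fb i1 x != 0)) => [fb_neq0|fb0].
    by exists (fb i1); split => // x; rewrite mu_r.
  have := nrm i1 i1; rewrite eqxx !big1 ?addr0.
  - by move=> /esym /eqP; rewrite oner_eq0.
  - move=> x _; apply/eqP; rewrite mulf_eq0 orbb.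
    by apply: contra_notT fb0 => ?; exists x.
  - move=> x _; apply/eqP; rewrite mulf_eq0 orbb.
    by apply: contra_notT fa0 => ?; exists x.
move=> g g0.
have dotr (m : 'M[R]_#|G|) i : (vec g *m m^T) 0 i = \sum_x g x * unvec (row i m) x.
  rewrite mxE (sum_enum_val (fun x => g x * unvec (row i m) x)).
  by apply: eq_bigr => k _; rewrite /unvec enum_valK !mxE.
(* The identity is diagonal in the same basis with all eigenvalues 1, so [spectral_form] also yields
   Parseval's identity and the two sums compare term by term. *)
have one_form (m : 'M[R]_#|G|) : m *m 1%:M = diag_mx (\row_i (fun=> 1) i) *m m.
  by rewrite mulmx1; apply/matrixP => i j; rewrite mul_diag_mx !mxE mul1r.
have := spectral_form (vec g) (laplacian_sym R G) aL bL ab1.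
have := spectral_form (vec g) (trmx1 _ _) (one_form a) (one_form b) ab1.
rewrite mulmx1 vec_laplacian !vec_mul.
have trE x : (vec g)^T (enum_rank x) 0 = g x by rewrite !mxE enum_rankK.
have -> : \sum_x g x * (vec g)^T (enum_rank x) 0 = \sum_x g x ^+ 2.
  by apply: eq_bigr => x _; rewrite trE expr2.
have -> : \sum_x lap g x * (vec g)^T (enum_rank x) 0 = \sum_x g x * lap g x.
  by apply: eq_bigr => x _; rewrite trE mulrC.
move=> -> ->; rewrite mulr_sumr; apply: ler_sum => i _; rewrite mul1r.
case: (eqVneq i i0) => [->|/r1le rle]; last first.
  by apply: ler_wpM2r => //; rewrite addr_ge0 ?sqr_ge0.
have [s [t' [fas fbt]]] := const _ ri0.
have zero m u : (forall x, unvec (row i0 m) x = u) -> (vec g *m m^T) 0 i0 = 0.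
  move=> mu_; rewrite dotr; under eq_bigr do rewrite mu_.
  by rewrite -mulr_suml g0 mul0r.
by rewrite (zero _ _ fas) (zero _ _ fbt) expr0n addr0 !mulr0.
Qed.

(** The zero sum is automatic: [sum_lap] gives [mu * \sum_x f x = 0] and [mu] is positive. Unit norm
    is obtained by scaling. *)
Lemma connectivity_eigenvector : exists f : G -> R,
  [/\ \sum_x f x = 0, \sum_x f x ^+ 2 = 1 & forall x, lap f x = mu * f x].
Proof.
have [mu_gt0 [f [[x fx] fE]] _] := connectivity_spectrum.
have nf_gt0 : 0 < \sum_x f x ^+ 2.
  rewrite (bigD1 x) //= ltr_wpDr ?exprn_even_gt0 //.
  by apply: sumr_ge0 => y _; exact: sqr_ge0.
exists (fun y => f y / Num.sqrt (\sum_x f x ^+ 2)); split.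
- rewrite -mulr_suml; have := sum_lap f; under eq_bigr do rewrite fE.
  by rewrite -mulr_sumr => /eqP; rewrite mulf_eq0 (gt_eqF mu_gt0) => /eqP ->; rewrite mul0r.
- under eq_bigr do rewrite expr_div_n sqr_sqrtr ?(ltW nf_gt0) //.
  by rewrite -mulr_suml divff // gt_eqF.
- move=> y; rewrite mulrA -fE /lap mulr_suml; apply: eq_bigr => z _.
  by rewrite mulrBl.
Qed.

(** Subtracting the mean leaves the energy unchanged and makes the spectral bound for zero-sum
    functions applicable. *)
Lemma connectivity_variance (g : G -> R) :
  2 * mu * \sum_x (g x - (\sum_y g y) / #|G|%:R) ^+ 2 <= energy g.
Proof.
set m := _ / _.
have [_ _ /(_ (fun x => g x - m))] := connectivity_spectrum.
have n_neq0 : (#|G|)%:R != 0 :> R by rewrite pnatr_eq0 -lt0n ltnW.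
have m0 : \sum_x (g x - m) = 0.
  by rewrite sumrB sumr_const -[m *+ _]mulr_natr /m divfK // subrr.
move=> /(_ m0) le_mu.
have -> : energy g = energy (fun x => g x - m).
  apply: eq_bigr => x _; apply: eq_bigr => y _; congr (_ ^+ 2); ring.
by rewrite energy_lap -mulrA ler_pM2l.
Qed.

End Connectivity.

(** * Bounds on eigenvectors along edges and paths *)

Section Estimates.
Variables (R : realType) (G : sgraph).

(* The flow [f u - f v] of the gradient leaves the superlevel set
   [f u <= f z], and the total outflow of that set is [k] times the sum of [f]
   over it. *)
Lemma eigen_edge_le (f : G -> R) k u v : 0 <= k ->
  (forall x, lap f x = k * f x) -> adj u v ->
  f u - f v <= k * \sum_x `|f x|.
Proof.
move=> k_ge0 fE uv.
have S_ge0 : 0 <= k * \sum_x `|f x| by rewrite mulr_ge0 // sumr_ge0.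
case: (leP (f u) (f v)) => [le_uv|lt_vu]; first by rewrite (le_trans _ S_ge0) // subr_le0.
pose A := [pred z | f u <= f z].
(* Flow along edges inside the superlevel set cancels in opposite pairs, so only outgoing edges
   remain; their flows are nonnegative, and the edge [uv] is one of them. *)
have inner : \sum_(z in A) \sum_(y in A | adj z y) (f z - f y) = 0.
  set s := LHS; suff : s = - s by move=> /eqP; rewrite -addr_eq0 -mulr2n mulrn_eq0 => /eqP.
  rewrite {1}/s (exchange_big_dep (mem A)) /=; last by move=> ? ? _ /andP [].
  rewrite -sumrN; apply: eq_bigr => z zA; rewrite -sumrN.
  apply: eq_big => [y|y _]; last by rewrite opprB.
  by rewrite adj_sym zA !inE.
have outer : \sum_(z in A) \sum_(y | adj z y) (f z - f y) =
    \sum_(z in A) \sum_(y | (y \notin A) && adj z y) (f z - f y).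
  under eq_bigr do rewrite (bigID (mem A)) /=; rewrite big_split /=.
  under eq_bigr do under eq_bigl do rewrite andbC.
  rewrite inner add0r; apply: eq_bigr => z _; apply: eq_bigl => y; exact: andbC.
have -> : f u - f v = \sum_(z in A | z == u) \sum_(y | [&& y \notin A, adj z y & y == v]) (f z - f y).
  rewrite (big_pred1 u) => [|z]; last by rewrite !inE; case: eqP => [->|]; rewrite ?lexx ?andbF.
  rewrite (big_pred1 v) // => y; rewrite !inE -ltNge.
  by case: eqP => [->|]; rewrite ?lt_vu ?uv ?andbF.
apply: (@le_trans _ _ (\sum_(z in A) lap f z)).
  have pos z y : z \in A -> y \notin A -> 0 <= f z - f y.
    rewrite !inE -ltNge subr_ge0 => uz /ltW yu; exact: le_trans uz.
  rewrite [leRHS]outer [leRHS](bigID (pred1 u)) /= ler_wpDr //.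
    by apply: sumr_ge0 => z /andP [zA _]; apply: sumr_ge0 => y /andP [yA _]; exact: pos.
  apply: ler_sum => z /andP [zA _]; rewrite [leRHS](bigID (pred1 v)) /=.
  under eq_bigl do rewrite andbA.
  rewrite ler_wpDr //; apply: sumr_ge0 => y /andP [/andP [yA _] _]; exact: pos.
under eq_bigr do rewrite fE.
rewrite -mulr_sumr ler_wpM2l // [leRHS](bigID (mem A)) /= ler_wpDr ?sumr_ge0 //.
by apply: ler_sum => z _; exact: ler_norm.
Qed.

Lemma eigen_edge_norm_le (f : G -> R) k u v : 0 <= k ->
  (forall x, lap f x = k * f x) -> adj u v ->
  `|f u - f v| <= k * \sum_x `|f x|.
Proof.
move=> k_ge0 fE uv; rewrite ler_norml eigen_edge_le // andbT.
by rewrite lerNl opprB eigen_edge_le // adj_sym.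
Qed.

(** Telescoping: each edge costs [(h x - h y) * (h x + h y) <= d * (h x + h y)]. An inner vertex is
    met twice and the first only once, whence the correction [- d * h x] that carries the
    induction. *)
Lemma sqr_path_le (h : G -> R) d x p : 0 <= d -> (forall y, 0 <= h y) ->
  (forall u v, adj u v -> `|h u - h v| <= d) -> path (@adj G) x p ->
  h x ^+ 2 <= h (last x p) ^+ 2 + 2 * d * \sum_(y <- x :: p) h y - d * h x.
Proof.
move=> d_ge0 h_ge0 hd; elim: p x => [|y p IHp] x /=.
  rewrite big_seq1 => _; have := mulr_ge0 d_ge0 (h_ge0 x); lra.
case/andP=> /hd; rewrite ler_norml => /andP [_ hxy] /IHp le_y.
rewrite big_cons mulrDr.
have : (h x - h y) * (h x + h y) <= d * (h x + h y).
  by rewrite ler_wpM2r // addr_ge0.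
lra.
Qed.

(** Telescoping squares bounds the drop from [v] to a vertex of opposite or zero sign by the sum of
    [|f|] over the path, with no factor for the length of the path. *)
Lemma sqr_eigen_le (f : G -> R) k v : gconnected G -> 0 <= k ->
  \sum_x f x = 0 -> (forall x, lap f x = k * f x) ->
  f v ^+ 2 <= 2 * k * (\sum_x `|f x|) ^+ 2.
Proof.
move=> [_ Gc] k_ge0 f0 fE; wlog fv_gt0 : f f0 fE / 0 < f v.
  move=> wl; case: (ltgtP 0 (f v)) => [|fv_lt0|<-]; first exact: wl.
    rewrite -sqrrN; under eq_bigr do rewrite -normrN.
    apply: (wl (fun x => - f x)); rewrite ?oppr_gt0 // ?sumrN ?f0 ?oppr0 // => x.
    by rewrite mulrN -fE /lap -sumrN; apply: eq_bigr => y _; ring.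
  by rewrite expr0n; apply: mulr_ge0; rewrite ?sqr_ge0 ?mulr_ge0.
have [w fw_le0] : exists w, f w <= 0.
  apply/not_existsP => f_gt0; suff : 0 < \sum_x f x by rewrite f0 ltxx.
  have f_ge0 x : 0 <= f x by apply/ltW; rewrite ltNge; apply/negP/f_gt0.
  by rewrite (bigD1 v) //= ltr_wpDr // sumr_ge0.
have /connectP [p0 /shortenP [p vp up _] wE] := Gc v w.
(* Truncation to the positive part keeps the edge bound, vanishes at [w] and agrees with [f] at
   [v]. *)
pose h x := Num.max (f x) 0; pose d := k * \sum_x `|f x|.
have h_ge0 x : 0 <= h x by rewrite le_max lexx orbT.
have h_le x : h x <= `|f x| by rewrite ge_max ler_norm normr_ge0.
have d_ge0 : 0 <= d by rewrite mulr_ge0 // sumr_ge0.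
have hd a b : adj a b -> `|h a - h b| <= d.
  move=> /(eigen_edge_norm_le k_ge0 fE); apply: le_trans.
  rewrite /h; case: (leP (f a) 0); case: (leP (f b) 0) => fb fa //;
    rewrite ?subrr ?normr0 ?subr0 ?sub0r ?normrN //.
    by rewrite (gtr0_norm fb) ler0_norm; lra.
  by rewrite (gtr0_norm fa) ger0_norm; lra.
have := sqr_path_le d_ge0 h_ge0 hd vp; rewrite -wE.
have -> : h w = 0 by exact/max_idPr.
have -> : h v = f v by exact/max_idPl/ltW.
(* The path has no repeated vertex, so its sum is part of the full one. *)
have : \sum_(y <- v :: p) h y <= \sum_x `|f x|.
  rewrite big_uniq // [leRHS](bigID (mem (v :: p))) /= ler_wpDr ?sumr_ge0 //.
  by apply: ler_sum.
move=> /(ler_wpM2l (mulr_ge0 (ler0n _ 2) d_ge0)); rewrite {2}/d.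
have := mulr_ge0 d_ge0 (ltW fv_gt0); rewrite expr0n /=.
set S := \sum_x _; have -> : 2 * k * S ^+ 2 = 2 * (k * S) * S by ring.
lra.
Qed.

(** A path without repetition has fewer than [#|G|] edges, so the search defining [gdist] succeeds
    within its range. *)
Lemma gdist_path x y : gconnected G -> exists2 p, path (@adj G) x p &
  last x p = y /\ size p = gdist x y.
Proof.
move=> [_ Gc]; rewrite /gdist; set P := (X in find X).
have hasP : has P (iota 0 #|G|).
  have /connectP [p0 /shortenP [p xp up _] yE] := Gc x y.
  apply/hasP; exists (size p).
    by rewrite mem_iota; have := max_card (mem (x :: p)); rewrite (card_uniqP up).
  by apply/existsP; exists (in_tuple p); rewrite xp yE eqxx.
have := nth_find 0%N hasP; rewrite nth_iota; last first.
  by move: hasP; rewrite has_find size_iota.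
move=> /existsP [p /andP [xp /eqP lp]]; exists p => //.
by rewrite size_tuple.
Qed.

Lemma gdist_lipschitz (f : G -> R) d x y : gconnected G ->
  (forall u v, adj u v -> `|f u - f v| <= d) ->
  `|f x - f y| <= (gdist x y)%:R * d.
Proof.
move=> Gc fd; have [p xp [<- <-]] := gdist_path x y Gc.
elim: p x xp => [|z p IHp] x /=; first by rewrite subrr normr0 mul0r.
case/andP => /fd fxz /IHp fz; rewrite (le_trans (ler_distD (f z) _ _)) //.
by rewrite -natr1 mulrDl mul1r addrC lerD.
Qed.

(** Cauchy-Schwarz against the constant 1, by expanding a sum of squares of deviations from the
    mean, scaled by [n]. *)
Lemma sqr_sum_norm_le (f : G -> R) :
  (\sum_x `|f x|) ^+ 2 <= #|G|%:R * \sum_x f x ^+ 2.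
Proof.
pose s := \sum_x `|f x|; pose n : R := #|G|%:R.
have : 0 <= \sum_x (n * `|f x| - s) ^+ 2 by apply: sumr_ge0 => x _; exact: sqr_ge0.
have -> : \sum_x (n * `|f x| - s) ^+ 2 = n * (n * \sum_x f x ^+ 2 - s ^+ 2).
  under eq_bigr do rewrite sqrrB exprMn real_normK ?num_real //.
  rewrite big_split sumrB /= -mulr_sumr sumr_const -[s ^+ 2 *+ _]mulr_natl.
  under [X in _ - X + _]eq_bigr do rewrite -mulrnAr -mulrA mulrCA.
  rewrite -mulr_suml -/s -/n; ring.
have [n_gt0|] := ltP 0 n; first by rewrite pmulr_rge0 // subr_ge0.
rewrite lern0 => /eqP G0 _; rewrite /s big1 => [|x _]; last first.
  by have := card0_eq G0 x.
by rewrite expr0n mulr_ge0 // sumr_ge0 // => x _; exact: sqr_ge0.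
Qed.

End Estimates.

(** * Two-sided comparison of [mu'] with [mu] *)

Section AttachEstimates.
Variables (R : realType) (G H : sgraph) (E : {set H * G}).
Local Notation G' := (attach E).
Local Notation mu := (algebraic_connectivity R G).
Local Notation mu' := (algebraic_connectivity R G').

Lemma sum_attach (F : G' -> R) :
  \sum_x F x = \sum_(x : G) F (inl x) + \sum_(h : H) F (inr h).
Proof. exact: big_sumType. Qed.

Lemma energy_attach (F : G' -> R) :
  energy F = energy (fun x : G => F (inl x)) + energy (fun h : H => F (inr h)) +
  2 * \sum_(h : H) \sum_(x | (h, x) \in E) (F (inr h) - F (inl x)) ^+ 2.
Proof.
have cross : \sum_(x : G) \sum_(h : H | (h, x) \in E) (F (inl x) - F (inr h)) ^+ 2 =
    \sum_(h : H) \sum_(x | (h, x) \in E) (F (inr h) - F (inl x)) ^+ 2.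
  rewrite (exchange_big_dep predT) //=; apply: eq_bigr => h _.
  by apply: eq_bigr => x _; rewrite -sqrrN opprB.
rewrite /energy sum_attach.
under eq_bigr do rewrite big_sumType /=.
under [X in _ + X]eq_bigr do rewrite big_sumType /=.
rewrite !big_split /=.
rewrite cross; ring.
Qed.

Hypotheses (G_conn : gconnected G) (G'_conn : gconnected G') (G_gt1 : (1 < #|G|)%N).

Lemma card_attach : #|G'| = (#|G| + #|H|)%N.
Proof. exact: card_sum. Qed.

Lemma attach_gt1 : (1 < #|G'|)%N.
Proof. by rewrite card_attach ltn_addr. Qed.

Lemma sum_sqr_sub (T : finType) (f : T -> R) m :
  \sum_x (f x - m) ^+ 2 = \sum_x f x ^+ 2 - 2 * m * \sum_x f x + #|T|%:R * m ^+ 2.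
Proof.
rewrite [_ * m ^+ 2]mulr_natl -sumr_const mulr_sumr -sumrB -big_split /=.
by apply: eq_bigr => x _; ring.
Qed.

Lemma attach_connectivity_le (S : {set G}) K :
  (forall h x, (h, x) \in E -> x \in S) -> (#|S| <= K)%N -> (#|H| <= K)%N ->
  (forall x y, x \in S -> y \in S -> (gdist x y <= K)%N) ->
  mu' <= mu + K%:R ^+ 4 * mu ^+ 2 * #|G|%:R.
Proof.
move=> ES SK HK Sdist.
have [mu_gt0 _ _] := connectivity_spectrum R G_conn G_gt1.
have [mu'_gt0 _ _] := connectivity_spectrum R G'_conn attach_gt1.
have [f [f0 f1 fE]] := connectivity_eigenvector R G_conn G_gt1.
pose d := mu * \sum_x `|f x|.
have d_ge0 : 0 <= d by rewrite mulr_ge0 ?sumr_ge0 ?ltW.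
have d_sqr : d ^+ 2 <= mu ^+ 2 * #|G|%:R.
  rewrite exprMn ler_wpM2l ?sqr_ge0 //.
  by have := sqr_sum_norm_le f; rewrite f1 mulr1.
have fd u v : adj u v -> `|f u - f v| <= d.
  exact: (eigen_edge_norm_le (ltW mu_gt0) fE).
(* If [S] is empty there are no attaching edges and any [c] will do. Otherwise the edge bound [d] is
   summed over a path of length at most [K] inside [G]. *)
have [c cS] : exists c, forall x, x \in S -> (c - f x) ^+ 2 <= (K%:R * d) ^+ 2.
  have [->|[s0 s0S]] := set_0Vmem S; first by exists 0 => x; rewrite inE.
  exists (f s0) => x xS; rewrite -[leLHS]real_normK ?num_real //.
  have Kd_ge0 : 0 <= K%:R * d by exact: mulr_ge0.
  rewrite lerXn2r ?nnegrE //.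
  rewrite (le_trans (gdist_lipschitz _ _ G_conn fd)) // ler_wpM2r //.
  by rewrite ler_nat Sdist.
pose F (u : G') : R := match u with inl x => f x | inr _ => c end.
have constE : energy (fun h : H => F (inr h)) = 0.
  by rewrite /energy big1 // => h _; rewrite big1 // => h' _; rewrite subrr expr0n.
have crossE : \sum_(h : H) \sum_(x | (h, x) \in E) (F (inr h) - F (inl x)) ^+ 2
    <= K%:R ^+ 4 * d ^+ 2.
  (* At most [K] vertices of [H], each with at most [K] neighbours in [S], each edge contributing at
     most [(K%:R * d) ^+ 2]. *)
  have -> : K%:R ^+ 4 * d ^+ 2 = K%:R * (K%:R * (K%:R * d) ^+ 2) by ring.
  have B_ge0 : 0 <= (K%:R * d) ^+ 2 by exact: sqr_ge0.
  apply: (@le_trans _ _ (\sum_(h : H) K%:R * (K%:R * d) ^+ 2)).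
    apply: ler_sum => h _; apply: (@le_trans _ _ (\sum_(x in S) (K%:R * d) ^+ 2)).
      rewrite big_mkcond [leRHS]big_mkcond; apply: ler_sum => x _.
      case: ifP => [/ES xS|_]; first by rewrite xS cS.
      by case: ifP.
    by rewrite sumr_const -[_ *+ #|_|]mulr_natl ler_wpM2r // ler_nat.
  by rewrite sumr_const -[_ *+ #|_|]mulr_natl ler_wpM2r ?ler_nat // mulr_ge0.
have := connectivity_variance G'_conn attach_gt1 F; set m := _ / _.
rewrite energy_attach constE addr0 (energy_eigen fE) f1.
(* Since [f] has zero sum and unit norm, its deviation from any [m] has squared norm at least 1 on
   [G] alone. *)
have var_ge1 : 1 <= \sum_x (F x - m) ^+ 2.
  rewrite sum_attach /= sum_sqr_sub f1 f0 mulr0 subr0 -addrA lerDl addr_ge0 //.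
    by rewrite mulr_ge0 ?sqr_ge0.
  by apply: sumr_ge0 => h _; exact: sqr_ge0.
have := ler_wpM2l (ltW mu'_gt0) var_ge1.
have := ler_wpM2l (exprn_ge0 4 (ler0n R K)) d_sqr.
rewrite -/F; lra.
Qed.

Lemma attach_connectivity_ge K : (#|H| <= K)%N ->
  mu * (1 - 2 * (K%:R + K%:R ^+ 2) * (mu' * #|G'|%:R)) <= mu'.
Proof.
move=> HK.
have [mu_gt0 _ _] := connectivity_spectrum R G_conn G_gt1.
have [mu'_gt0 _ _] := connectivity_spectrum R G'_conn attach_gt1.
have [g [g0 g1 gE]] := connectivity_eigenvector R G'_conn attach_gt1.
(* The pointwise bound [sqr_eigen_le] combined with Cauchy-Schwarz for the unit vector [g]. *)
pose s := 2 * mu' * #|G'|%:R.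
have g_le v : g v ^+ 2 <= s.
  rewrite (le_trans (sqr_eigen_le v G'_conn (ltW mu'_gt0) g0 gE)) //.
  apply: ler_wpM2l; first by rewrite mulr_ge0 // ltW.
  by have := sqr_sum_norm_le g; rewrite g1 mulr1.
have s_ge0 : 0 <= s by rewrite !mulr_ge0 // ltW.
(* Restricting to [G] loses the mass [q] and shifts the sum by [w]; they are responsible for the
   terms [K%:R] and [K%:R ^+ 2] of the bound. *)
pose f x := g (inl x); pose w := \sum_(h : H) g (inr h).
pose q := \sum_(h : H) g (inr h) ^+ 2.
have fw : \sum_x f x = - w by apply/eqP; rewrite -addr_eq0 -sum_attach g0.
have fq : \sum_x f x ^+ 2 = 1 - q by rewrite -g1 sum_attach /= addrK.
have q_le : q <= K%:R * s.
  apply: (@le_trans _ _ (\sum_(h : H) s)); first by apply: ler_sum => h _.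
  by rewrite sumr_const -[_ *+ #|_|]mulr_natl ler_wpM2r // ler_nat.
have w_le : w ^+ 2 <= K%:R ^+ 2 * s.
  rewrite -real_normK ?num_real //.
  apply: (@le_trans _ _ ((\sum_(h : H) `|g (inr h)|) ^+ 2)).
    by rewrite lerXn2r ?nnegrE ?sumr_ge0 // ler_norm_sum.
  apply: (le_trans (sqr_sum_norm_le (fun h : H => g (inr h)))).
  apply: (@le_trans _ _ (K%:R * q)); last by rewrite expr2 -mulrA ler_wpM2l.
  by rewrite ler_wpM2r ?ler_nat //; apply: sumr_ge0 => h _; exact: sqr_ge0.
have energy_le : energy f <= 2 * mu'.
  have <- : energy g = 2 * mu' by rewrite (energy_eigen gE) g1 mulr1.
  rewrite energy_attach -addrA lerDl.
  rewrite addr_ge0 ?energy_ge0 // mulr_ge0 //.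
  by apply: sumr_ge0 => h _; apply: sumr_ge0 => x _; exact: sqr_ge0.
have := connectivity_variance G_conn G_gt1 f; rewrite fw sum_sqr_sub fq fw.
have n_ge1 : 1 <= #|G|%:R :> R by rewrite ler1n ltnW.
have -> : 1 - q - 2 * (- w / #|G|%:R) * - w + #|G|%:R * (- w / #|G|%:R) ^+ 2 =
    1 - q - w ^+ 2 / #|G|%:R.
  by field; rewrite gt_eqF // (lt_le_trans ltr01).
have wn : w ^+ 2 / #|G|%:R <= w ^+ 2.
  by rewrite ler_piMr ?sqr_ge0 // invf_le1 // (lt_le_trans ltr01).
have : 1 - (K%:R + K%:R ^+ 2) * s <= 1 - q - w ^+ 2 / #|G|%:R by lra.
move=> /(ler_wpM2l (ltW mu_gt0)).
have -> : 2 * (K%:R + K%:R ^+ 2) * (mu' * #|G'|%:R) = (K%:R + K%:R ^+ 2) * s.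
  by rewrite /s; ring.
lra.
Qed.

End AttachEstimates.

(** * From the two inequalities to the limit *)

Lemma ratio_bound (R : realType) (K n N : nat) (m m' e : R) : 0 < m ->
  (1 <= n)%N -> (N <= n + K)%N -> 0 < e -> e <= 1 ->
  m' <= m + K%:R ^+ 4 * m ^+ 2 * n%:R ->
  m * (1 - 2 * (K%:R + K%:R ^+ 2) * (m' * N%:R)) <= m' ->
  m * n%:R <= e / (8 * (K%:R + 1) ^+ 4) ->
  `|m' / m - 1| <= e.
Proof.
move=> m_gt0 n_gt0 NK e_gt0 e_le1 up low; set k : R := K%:R in up low *.
have k_ge0 : 0 <= k by exact: ler0n.
have p_gt0 : 0 < 8 * (k + 1) ^+ 4 by rewrite mulr_gt0 // exprn_gt0 // ltr_wpDl.
rewrite ler_pdivlMr // => small.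
set t := m * n%:R in small.
have t_ge0 : 0 <= t by rewrite mulr_ge0 // ltW.
have n_ge1 : 1 <= n%:R :> R by rewrite ler1n.
have N_le : N%:R <= (k + 1) * n%:R :> R.
  apply: (@le_trans _ _ (n%:R + k)); first by rewrite -natrD ler_nat.
  by have : k * 1 <= k * n%:R; [rewrite ler_wpM2l | lra].
have kt : k ^+ 4 * t <= e / 8.
  have : k ^+ 4 <= (k + 1) ^+ 4 by rewrite lerXn2r ?nnegrE //; lra.
  move=> /(ler_wpM2r t_ge0); lra.
have up' : m' <= m * (1 + k ^+ 4 * t) by rewrite /t; lra.
(* Since [e <= 1], the upper bound already gives [m' <= 2 m]; this removes [m'] from the error term
   of the lower bound. *)
have up2 : m' <= m * 2 by rewrite (le_trans up') // ler_pM2l //; lra.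
have mN : m' * N%:R <= 2 * (k + 1) * t.
  apply: (@le_trans _ _ (m * 2 * N%:R)); first by rewrite ler_wpM2r.
  have := ler_wpM2l (ltW m_gt0) N_le; rewrite /t; lra.
(* The left side is [4 * k * (k + 1) ^+ 2 * t], so the constant [8 * (k + 1) ^+ 4] in [small] even
   bounds it by [e / 2]. *)
have kk : 2 * (k + k ^+ 2) * (2 * (k + 1) * t) <= e.
  have kk' : k * (k + 1) ^+ 2 <= (k + 1) ^+ 4.
    have -> : (k + 1) ^+ 4 = (k + 1) ^+ 2 * (k + 1) ^+ 2 by ring.
    by rewrite ler_wpM2r ?sqr_ge0 //; nra.
  have -> : 2 * (k + k ^+ 2) * (2 * (k + 1) * t) = 4 * (k * (k + 1) ^+ 2 * t) by ring.
  by have := ler_wpM2r t_ge0 kk'; lra.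
have low' : m * (1 - e) <= m'.
  apply: le_trans low; rewrite ler_pM2l // lerD2l lerN2.
  apply: le_trans kk; apply: ler_wpM2l => //; nra.
rewrite ler_norml; apply/andP; split.
  by rewrite lerBrDr ler_pdivlMr //; lra.
rewrite lerBlDr ler_pdivrMr //.
by rewrite (le_trans up') // mulrC ler_pM2r //; lra.
Qed.

Unset Implicit Arguments.
Unset Printing Implicit Defensive.

Theorem theorem3 (R : realType) (G H : nat -> sgraph)
    (S : forall k, {set G k}) (E : forall k, {set H k * G k}) (K : nat)
    (G_connected : forall k, gconnected (G k))
    (G_order : forall k, (2 <= #|G k|)%N)
    (mu_small : (fun k => algebraic_connectivity R (G k) : R^o) =o_\oo
                (fun k => #|G k|%:R^-1 : R^o))
    (E_S : forall k (h : H k) (x : G k), (h, x) \in E k -> x \in S k)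
    (G'_connected : forall k, gconnected (attach (E k)))
    (S_card : forall k, (#|S k| <= K)%N)
    (H_order : forall k, (#|H k| <= K)%N)
    (S_dist : forall k (x y : G k), x \in S k -> y \in S k ->
                (gdist x y <= K)%N) :
  exists2 eps : nat -> R^o, eps =o_\oo (fun _ => 1 : R^o) &
    forall k, algebraic_connectivity R (attach (E k)) =
              (1 + eps k) * algebraic_connectivity R (G k).
Proof.
pose mu k := algebraic_connectivity R (G k).
have mu_gt0 k : 0 < mu k.
  by have [] := connectivity_spectrum R (G_connected k) (G_order k).
pose mu' k := algebraic_connectivity R (attach (E k)).
exists (fun k => mu' k / mu k - 1); last first.
  by move=> k; rewrite -/(mu k) addrCA subrr addr0 divfK // gt_eqF.
(* Capping [e] at 1 meets the requirement [e <= 1] of [ratio_bound]. *)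
apply/eqoP => e e_gt0; pose e1 := Num.min e 1.
have e1_gt0 : 0 < e1 by rewrite lt_min e_gt0 ltr01.
have c_gt0 : 0 < e1 / (8 * (K%:R + 1) ^+ 4).
  by rewrite divr_gt0 // mulr_gt0 // exprn_gt0 // ltr_wpDl.
move/eqoP : mu_small => /(_ _ c_gt0); apply: filterS => k.
have n_gt0 : 0 < #|G k|%:R :> R by rewrite ltr0n ltnW.
rewrite /= normr1 mulr1 -/(mu k) (gtr0_norm (mu_gt0 k)) normfV (gtr0_norm n_gt0).
rewrite -[_ * _^-1]/(_ / _) (ler_pdivlMr _ _ n_gt0) => small.
apply: (@le_trans _ _ e1); last by rewrite ge_min lexx.
apply: (ratio_bound (N := #|attach (E k)|) (mu_gt0 k) _ _ e1_gt0 _ _ _ small).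
- exact: ltnW.
- by rewrite card_attach leq_add2l.
- by rewrite ge_min lexx orbT.
- exact: (attach_connectivity_le _ (G_connected k) (G'_connected k) (G_order k)
    (@E_S k) (S_card k) (H_order k) (@S_dist k)).
- exact: (attach_connectivity_ge _ (G_connected k) (G'_connected k) (G_order k)).
Qed.
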